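(* Let $W:\mathrm{GL}^+(2)\to\mathbb{R}$ be an objective, isotropic and isochoric function, and let $h:\mathbb{R}^+\to\mathbb{R}$ and $g:\mathbb{R}^+\times\mathbb{R}^+\to\mathbb{R}$ denote the uniquely determined functions with $$W(F)=g(\lambda_1,\lambda_2)=h\left(\frac{\lambda_1}{\lambda_2}\right)=h\left(\frac{\lambda_2}{\lambda_1}\right)$$ for all $F\in\mathrm{GL}^+(2)$ with singular values $\lambda_1,\lambda_2$. Then the following are equivalent: (i) $W$ is polyconvex; (ii) $W$ is rank-one convex; (iii) $g$ is separately convex; (iv) $h$ is convex on $\mathbb{R}^+$; (v) $h$ is convex and non-decreasing on $[1,\infty)$.
   Context: $\mathbb{R}^+=(0,\infty)$; $\mathrm{GL}^+(2)=\{X\in\mathbb{R}^{2\times2} : \det X>0\}$; $\mathrm{SO}(2)$ is the special orthogonal group. A function $W:\mathrm{GL}^+(2)\to\mathbb{R}$ is objective and isotropic if $W(Q_1FQ_2)=W(F)$ for all $F\in\mathrm{GL}^+(2)$ and $Q_1,Q_2\in\mathrm{SO}(2)$; it is isochoric if $W(aF)=W(F)$ for all $F\in\mathrm{GL}^+(2)$ and all $a>0$. The singular values $\lambda_1,\lambda_2>0$ of $F$ may be taken in either order; $g$ is symmetric ($g(\lambda_1,\lambda_2)=g(\lambda_2,\lambda_1)$) and $h(t)=h(1/t)$. $W$ is polyconvex if there is a convex function $P:\mathbb{R}^{2\times2}\times\mathbb{R}\to\mathbb{R}\cup\{+\infty\}$ with $W(F)=P(F,\det F)$ for all $F\in\mathrm{GL}^+(2)$.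 $W$ is rank-one convex (on $\mathrm{GL}^+(2)$) if $W(F+(1-\theta)\,\xi\otimes\eta)\le\theta W(F)+(1-\theta)W(F+\xi\otimes\eta)$ for all $F\in\mathrm{GL}^+(2)$, $\theta\in[0,1]$ and all $\xi,\eta\in\mathbb{R}^2$ such that $F+t\,\xi\otimes\eta\in\mathrm{GL}^+(2)$ for all $t\in[0,1]$, where $\xi\otimes\eta=\xi\eta^T$. $g$ is separately convex if $\lambda_1\mapsto g(\lambda_1,\lambda_2)$ is convex on $\mathbb{R}^+$ for each fixed $\lambda_2\in\mathbb{R}^+$ and $\lambda_2\mapsto g(\lambda_1,\lambda_2)$ is convex on $\mathbb{R}^+$ for each fixed $\lambda_1\in\mathbb{R}^+$. *)

(* Defs.v *)
From HB Require Import structures.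
From mathcomp Require Import all_boot all_order all_algebra.
From mathcomp Require Import all_classical all_reals all_analysis.

Set Implicit Arguments.
Unset Strict Implicit.
Unset Printing Implicit Defensive.

Import Order.TTheory GRing.Theory Num.Theory.

Local Open Scope classical_set_scope.
Local Open Scope ring_scope.

(* Functions on GL+(2), R+ and R+ x R+ are total Rocq functions; nothing below
   depends on their values outside these domains. *)

Definition GLplus2 (R : realType) : set 'M[R]_2 := [set F | 0 < \det F].

Definition SO2 (R : realType) : set 'M[R]_2 :=
  [set Q | Q^T *m Q = 1%:M /\ \det Q = 1].

Definition objective_isotropic (R : realType) (W : 'M[R]_2 -> R) : Prop :=
  forall F Q1 Q2 : 'M[R]_2, GLplus2 F -> SO2 Q1 -> SO2 Q2 ->
    W (Q1 *m F *m Q2) = W F.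

Definition isochoric (R : realType) (W : 'M[R]_2 -> R) : Prop :=
  forall (F : 'M[R]_2) (a : R), GLplus2 F -> 0 < a -> W (a *: F) = W F.

(* l1^2 and l2^2 are the eigenvalues of F^T F, with multiplicity and in either
   order. *)
Definition singular_values (R : realType) (F : 'M[R]_2) (l1 l2 : R) : Prop :=
  [/\ 0 <= l1, 0 <= l2 &
      char_poly (F^T *m F) = ('X - (l1 ^+ 2)%:P) * ('X - (l2 ^+ 2)%:P)].

Definition represents (R : realType) (W : 'M[R]_2 -> R)
    (g : R -> R -> R) (h : R -> R) : Prop :=
  forall (F : 'M[R]_2) (l1 l2 : R), GLplus2 F -> singular_values F l1 l2 ->
    [/\ W F = g l1 l2, W F = h (l1 / l2) & W F = h (l2 / l1)].

Definition ereal_convex (R : realType) (P : 'M[R]_2 -> R -> \bar R) : Prop :=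
  forall (X Y : 'M[R]_2) (a b t : R), 0 <= t <= 1 ->
    (P (t *: X + (1 - t) *: Y)%R (t * a + (1 - t) * b)%R
       <= t%:E * P X a + (1 - t)%:E * P Y b)%E.

Definition polyconvex (R : realType) (W : 'M[R]_2 -> R) : Prop :=
  exists P : 'M[R]_2 -> R -> \bar R,
    [/\ forall X a, P X a != -oo%E,
        ereal_convex P &
        forall F, GLplus2 F -> (W F)%:E = P F (\det F)].

Definition rank_one_convex (R : realType) (W : 'M[R]_2 -> R) : Prop :=
  forall (F : 'M[R]_2) (theta : R) (xi eta : 'cV[R]_2),
    GLplus2 F -> 0 <= theta <= 1 ->
    (forall t : R, 0 <= t <= 1 -> GLplus2 (F + t *: (xi *m eta^T))) ->
    W (F + (1 - theta) *: (xi *m eta^T))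
      <= theta * W F + (1 - theta) * W (F + xi *m eta^T).

Definition convex_on (R : realType) (D : set R) (f : R -> R) : Prop :=
  @convex_function R R^o D f.

Definition separately_convex (R : realType) (g : R -> R -> R) : Prop :=
  (forall l2 : R, 0 < l2 -> convex_on `]0, +oo[ (fun l1 => g l1 l2)) /\
  (forall l1 : R, 0 < l1 -> convex_on `]0, +oo[ (fun l2 => g l1 l2)).

Definition nondecreasing_on (R : realType) (D : set R) (f : R -> R) : Prop :=
  {in D &, {homo f : x y / x <= y}}.

(* Main.v *)
(* By the singular value decomposition with factors in SO(2), W F depends only
   on the ratio l1/l2, which gives g, h and their uniqueness. The step needing
   an idea is (v) => (i): if l1 >= l2 then l1/l2 = l1^2 / det F, where the
   largest singular value l1 is a convex function of F (a norm) and
   (x, d) |-> x^2/d is convex for d > 0; composing with the convex nondecreasing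
   h gives a convex function of (F, det F). For (i) => (ii), det is affine along
   rank-one lines; for (ii) => (iii), varying one entry of a diagonal matrix is a
   rank-one line. *)
Require Import Defs.
From mathcomp Require Import all_boot all_order all_algebra.
From mathcomp Require Import all_classical all_reals all_analysis.
From mathcomp Require Import ring lra.

Set Implicit Arguments.
Unset Strict Implicit.
Unset Printing Implicit Defensive.

Import Order.TTheory GRing.Theory Num.Theory.

Local Open Scope classical_set_scope.
Local Open Scope ring_scope.

(** * Two-by-two matrices in terms of their entries *)

Section Matrix22.
Context {R : comNzRingType}.
Implicit Types (F G : 'M[R]_2) (a b c d e f g h : R).

Definition mx22 a b c d : 'M[R]_2 :=
  \matrix_(i, j) if i == 0 then if j == 0 then a else b
                 else if j == 0 then c else d.

Lemma mx22P F G : F 0 0 = G 0 0 -> F 0 1 = G 0 1 -> F 1 0 = G 1 0 ->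
  F 1 1 = G 1 1 -> F = G.
Proof.
move=> e00 e01 e10 e11; apply/matrixP => i j.
have I2 (k : 'I_2) : k = 0 \/ k = 1.
  by case: k => [[|[|//]] ?]; [left|right]; apply: val_inj.
by case: (I2 i) => ->; case: (I2 j) => ->.
Qed.

Lemma mx22_eta F : F = mx22 (F 0 0) (F 0 1) (F 1 0) (F 1 1).
Proof. by apply: mx22P; rewrite !mxE. Qed.

Lemma mul_mx22 a b c d e f g h :
  mx22 a b c d *m mx22 e f g h =
  mx22 (a * e + b * g) (a * f + b * h) (c * e + d * g) (c * f + d * h).
Proof. by apply: mx22P; rewrite !mxE !big_ord_recl big_ord0 !mxE /= addr0. Qed.

Lemma add_mx22 a b c d e f g h :
  mx22 a b c d + mx22 e f g h = mx22 (a + e) (b + f) (c + g) (d + h).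
Proof. by apply: mx22P; rewrite !mxE. Qed.

Lemma scale_mx22 t a b c d :
  t *: mx22 a b c d = mx22 (t * a) (t * b) (t * c) (t * d).
Proof. by apply: mx22P; rewrite !mxE. Qed.

Lemma tr_mx22 a b c d : (mx22 a b c d)^T = mx22 a c b d.
Proof. by apply: mx22P; rewrite !mxE. Qed.

Lemma scalar_mx22 a : a%:M = mx22 a 0 0 a.
Proof. by apply: mx22P; rewrite !mxE. Qed.

Lemma det_mx22 a b c d : \det (mx22 a b c d) = a * d - b * c.
Proof.
rewrite (expand_det_row _ 0) !big_ord_recl big_ord0 addr0 /cofactor !det_mx11.
rewrite !mxE /=; ring.
Qed.

End Matrix22.

(** * Singular values and the decomposition with factors in SO(2) *)

Section SingularValues.
Context {R : realType}.
Implicit Types (F : 'M[R]_2) (a b c d p q r A B l : R).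

Lemma char_poly_mx22 a b c d : char_poly (mx22 a b c d) =
  ('X - a%:P) * ('X - d%:P) - (b * c)%:P.
Proof.
rewrite /char_poly /char_poly_mx.
have -> : 'X%:M - map_mx polyC (mx22 a b c d) =
  mx22 ('X - a%:P) (- b%:P) (- c%:P) ('X - d%:P).
  by apply: mx22P; rewrite !mxE /= ?sub0r.
by rewrite det_mx22 mulrNN polyCM.
Qed.

(** Comparing coefficients of monic quadratics: the sum is the trace of F^T F, and the product is
    its determinant, the square of [\det F]. *)
Lemma singular_valuesP a b c d l1 l2 :
  singular_values (mx22 a b c d) l1 l2 <->
  [/\ 0 <= l1, 0 <= l2,
      l1 ^+ 2 + l2 ^+ 2 = a ^+ 2 + b ^+ 2 + c ^+ 2 + d ^+ 2 &
      l1 ^+ 2 * l2 ^+ 2 = (a * d - b * c) ^+ 2].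
Proof.
rewrite /singular_values tr_mx22 mul_mx22 char_poly_mx22.
split=> [[l10 l20 e]|[l10 l20 e1 e2]]; first last.
  split=> //.
  set p := a * a + _; set q := a * b + _; set r := _ + d * d.
  have -> : b * a + d * c = q by rewrite /q; ring.
  have pr : p + r = l1 ^+ 2 + l2 ^+ 2 by rewrite e1 /p /r; ring.
  have pq : p * r - q * q = l1 ^+ 2 * l2 ^+ 2 by rewrite e2 /p /q /r; ring.
  move: p q r pr pq => p q r pr pq.
  have -> : ('X - p%:P) * ('X - r%:P) - (q * q)%:P =
    'X ^+ 2 - (p + r)%:P * 'X + (p * r - q * q)%:P.
    by rewrite polyCB !polyCM polyCD; ring.
  by rewrite pr pq polyCD !polyCM; ring.
(* Evaluating the polynomial identity at 0 gives the product of the squares; evaluating it at 1 then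
   gives their sum. *)
have e0 : (a * a + c * c) * (b * b + d * d) -
    (a * b + c * d) * (a * b + c * d) = l1 ^+ 2 * l2 ^+ 2.
  have E := congr1 (horner^~ 0) e; rewrite !hornerE in E.
  by rewrite -[RHS]mulrNN -E; ring.
have e1 : (1 - (a * a + c * c)) * (1 - (b * b + d * d)) -
    (a * b + c * d) * (a * b + c * d) = (1 - l1 ^+ 2) * (1 - l2 ^+ 2).
  have E := congr1 (horner^~ 1) e; rewrite !hornerE in E.
  by rewrite -E; ring.
split=> //.
- have -> : l1 ^+ 2 + l2 ^+ 2 =
    1 - (1 - l1 ^+ 2) * (1 - l2 ^+ 2) + l1 ^+ 2 * l2 ^+ 2 by ring.
  by rewrite -e0 -e1; ring.
- by rewrite -e0; ring.
Qed.

Lemma singular_valuesC F l1 l2 :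
  singular_values F l1 l2 -> singular_values F l2 l1.
Proof. by case=> l10 l20 e; split=> //; rewrite mulrC. Qed.

(** Both [l1 * l2] and [\det F] are nonnegative with equal squares, hence equal; a positive product
    has no zero factor. *)
Lemma singular_values_gt0 F l1 l2 : GLplus2 F -> singular_values F l1 l2 ->
  [/\ 0 < l1, 0 < l2 & l1 * l2 = \det F].
Proof.
rewrite (mx22_eta F) /GLplus2 /= det_mx22 => F0 /singular_valuesP[l10 l20 _ e].
have e' : l1 * l2 = F 0 0 * F 1 1 - F 0 1 * F 1 0.
  by apply/eqP; rewrite -(eqrXn2 (n:=2)) ?mulr_ge0 ?(ltW F0) ?exprMn ?e.
have := F0; rewrite -e' => l0.
by split=> //; rewrite lt_neqAle ?l10 ?l20 andbT eq_sym;
  apply: contraTneq l0 => ->; rewrite ?mul0r ?mulr0 ltxx.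
Qed.

Lemma singular_values_diag l1 l2 : 0 <= l1 -> 0 <= l2 ->
  singular_values (mx22 l1 0 0 l2) l1 l2.
Proof. by move=> l10 l20; apply/singular_valuesP; split=> //; ring. Qed.

Lemma rotationP a b : a ^+ 2 + b ^+ 2 = 1 -> SO2 (mx22 a (- b) b a).
Proof.
move=> ab; split; last by rewrite det_mx22 -ab; ring.
by rewrite tr_mx22 mul_mx22 scalar_mx22 -ab; congr mx22; ring.
Qed.

(** For the symmetric matrix with rows (p, q) and (q, r), the vector (q, A - p) satisfies the first
    eigenvector equation identically; trace and determinant give the second. *)
Lemma eigenvector22 p q r A B : p + r = A + B -> p * r - q ^+ 2 = A * B ->
  exists u v : R, [/\ u ^+ 2 + v ^+ 2 = 1, p * u + q * v = A * u &
    q * u + r * v = A * v].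
Proof.
move=> tr dt; set n := Num.sqrt (q ^+ 2 + (A - p) ^+ 2).
have n2 : n ^+ 2 = q ^+ 2 + (A - p) ^+ 2 by rewrite sqr_sqrtr ?addr_ge0 ?sqr_ge0.
(* If (q, A - p) vanishes, the matrix is diagonal with p = A, and the first basis vector serves
   instead. *)
have [n0|n0] := eqVneq n 0.
  move: n2; rewrite n0 expr0n => /esym/eqP.
  rewrite paddr_eq0 ?sqr_ge0 // !sqrf_eq0 subr_eq0 => /andP[/eqP q0 /eqP Ap].
  by exists 1, 0; split; rewrite ?q0 ?Ap; ring.
exists (q / n), ((A - p) / n); split.
- by rewrite !expr_div_n -mulrDl -n2 divff // sqrf_eq0.
- by field.
- have -> : q * (q / n) + r * ((A - p) / n) = (q ^+ 2 + r * (A - p)) / n.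
    by field.
  rewrite mulrA; congr (_ / _); rewrite -[q ^+ 2](subKr (p * r)) dt.
  have -> : r = A + B - p by rewrite -tr addrC addKr.
  ring.
Qed.

(* If (u, v) is a unit eigenvector of F^T F for l1^2, then (-v, u) is one for
   l2^2, and the images under F of these two vectors divided by l1, l2 are the
   columns of the left rotation. *)
Lemma svd22 F l1 l2 : GLplus2 F -> singular_values F l1 l2 ->
  exists Q1 Q2 : 'M[R]_2,
    [/\ SO2 Q1, SO2 Q2 & F = Q1 *m mx22 l1 0 0 l2 *m Q2].
Proof.
move=> F0 sF; have [l10 l20] := singular_values_gt0 F0 sF.
move: sF; rewrite (mx22_eta F) det_mx22.
move: (F 0 0) (F 0 1) (F 1 0) (F 1 1) => a b c d {F F0}.
move=> /singular_valuesP[_ _ tr dt] l12.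
have [||u [v [uv e1 e2]]] := @eigenvector22 (a ^+ 2 + c ^+ 2) (a * b + c * d)
    (b ^+ 2 + d ^+ 2) (l1 ^+ 2) (l2 ^+ 2).
- by rewrite tr; ring.
- by rewrite dt; ring.
have l1n : l1 != 0 by rewrite gt_eqF.
have l2n : l2 != 0 by rewrite gt_eqF.
set x := (a * u + b * v) / l1; set y := (c * u + d * v) / l1.
have l1x : x * l1 = a * u + b * v by rewrite /x divfK.
have l1y : y * l1 = c * u + d * v by rewrite /y divfK.
(* With [l2x] this says that F maps (-v, u) to l2 (-y, x). The factor [l1 ^+ 2] makes the
   eigenvector equations and [l12] applicable. *)
have l2y : y * l2 = a * v - b * u.
  apply: (mulfI (expf_neq0 2 l1n)).
  have -> : l1 ^+ 2 * (y * l2) = (l1 * l2) * (y * l1) by ring.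
  have -> : l1 ^+ 2 * (a * v - b * u) =
    a * (l1 ^+ 2 * v) - b * (l1 ^+ 2 * u) by ring.
  by rewrite l1y l12 -e1 -e2; ring.
have l2x : x * l2 = d * u - c * v.
  apply: (mulfI (expf_neq0 2 l1n)).
  have -> : l1 ^+ 2 * (x * l2) = (l1 * l2) * (x * l1) by ring.
  have -> : l1 ^+ 2 * (d * u - c * v) =
    d * (l1 ^+ 2 * u) - c * (l1 ^+ 2 * v) by ring.
  by rewrite l1x l12 -e1 -e2; ring.
have xy : x ^+ 2 + y ^+ 2 = 1.
  apply: (mulfI (expf_neq0 2 l1n)).
  have -> : l1 ^+ 2 * (x ^+ 2 + y ^+ 2) = (x * l1) ^+ 2 + (y * l1) ^+ 2 by ring.
  have -> : l1 ^+ 2 * 1 = u * (l1 ^+ 2 * u) + v * (l1 ^+ 2 * v).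
    by rewrite -[in LHS]uv; ring.
  by rewrite l1x l1y -e1 -e2; ring.
exists (mx22 x (- y) y x), (mx22 u (- - v) (- v) u); split.
- exact: rotationP.
- by apply: rotationP; rewrite sqrrN.
rewrite !mul_mx22 !mulr0 !addr0 !add0r !mulNr l1x l1y l2x l2y.
by congr mx22; rewrite -[LHS]mulr1 -uv; ring.
Qed.

End SingularValues.

(** * Existence of g and h, and their values read off diagonal matrices *)

Section Representation.
Context {R : realType}.
Context {W : 'M[R]_2 -> R}.

(** The rotations of [svd22] are absorbed by objectivity and isotropy, and scaling by the inverse of
    l2 leaves only the ratio. *)
Lemma represents_exists : objective_isotropic W -> isochoric W ->
  represents W (fun l1 l2 => W (mx22 l1 0 0 l2)) (fun t => W (mx22 t 0 0 1)).
Proof.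
move=> Woi Wiso.
have WE F l1 l2 : GLplus2 F -> singular_values F l1 l2 ->
    W F = W (mx22 l1 0 0 l2) /\ W F = W (mx22 (l1 / l2) 0 0 1).
  move=> F0 sF; have [l10 l20 _] := singular_values_gt0 F0 sF.
  have [Q1 [Q2 [Q1R Q2R ->]]] := svd22 F0 sF.
  have D0 : GLplus2 (mx22 l1 0 0 l2).
    by rewrite /GLplus2 /= det_mx22 mulr0 subr0 mulr_gt0.
  rewrite Woi //; split=> //.
  have <- : l2^-1 *: mx22 l1 0 0 l2 = mx22 (l1 / l2) 0 0 1.
    by rewrite scale_mx22 mulr0 mulrC mulVf // gt_eqF.
  by rewrite Wiso // invr_gt0.
move=> F l1 l2 F0 sF; have [Wg Wh] := WE _ _ _ F0 sF.
by have [_ Wh'] := WE _ _ _ F0 (singular_valuesC sF).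
Qed.

Context {g : R -> R -> R} {h : R -> R} (Wgh : represents W g h).

(** Every pair of positive numbers is realised as singular values by a diagonal matrix, so W
    determines g and h on their domains. *)
Lemma represents_diag l1 l2 : 0 < l1 -> 0 < l2 ->
  [/\ W (mx22 l1 0 0 l2) = g l1 l2, g l1 l2 = h (l1 / l2) &
      g l1 l2 = h (l2 / l1)].
Proof.
move=> l10 l20; have D0 : GLplus2 (mx22 l1 0 0 l2).
  by rewrite /GLplus2 /= det_mx22 mulr0 subr0 mulr_gt0.
by have [-> -> /esym ->] :=
  Wgh D0 (singular_values_diag (ltW l10) (ltW l20)).
Qed.

Lemma represents_ratio t : 0 < t -> h t = g t 1.
Proof. by move=> t0; have [_ -> _] := represents_diag t0 ltr01; rewrite divr1. Qed.

Lemma represents_inv t : 0 < t -> h t^-1 = h t.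
Proof.
move=> t0; have [_ e1 e2] := represents_diag t0 ltr01.
by rewrite -[t^-1]mul1r -e2 e1 divr1.
Qed.

End Representation.

(** * Convexity tools and the largest singular value *)

Section Convexity.
Context {R : realType}.
Implicit Types (D : set R) (f : R -> R) (t x y a b : R).

Lemma convex_onP D f : convex_on D f <->
  forall t x y, 0 <= t <= 1 -> D x -> D y ->
    f (t * x + (1 - t) * y) <= t * f x + (1 - t) * f y.
Proof.
split=> [fc t x y /andP[t0 t1] Dx Dy|fc t x y /set_mem Dx /set_mem Dy].
  by have := fc (Itv01 t0 t1) x y (mem_set Dx) (mem_set Dy).
by apply: fc => //; apply/andP; split.
Qed.

(** Extending f by the constant f 1 below 1 keeps it convex and monotone, since s |-> max(s, 1) is
    convex. This serves pairs (X, a) with a different from [\det X], where the squared norm of X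
    over a may be below 1. *)
Lemma convex_on_extend1 f : convex_on `[1, +oo[ f ->
  nondecreasing_on `[1, +oo[ f ->
  convex_on setT (fun s => f (Num.max s 1)) /\
  {homo (fun s => f (Num.max s 1)) : x y / x <= y}.
Proof.
move=> /convex_onP fc fh.
have hm x y : 1 <= x -> 1 <= y -> x <= y -> f x <= f y.
  by move=> x1 y1; apply: fh; rewrite inE /= in_itv /= andbT.
have max1 (s : R) : 1 <= Num.max s 1 by rewrite le_max lexx orbT.
have M1 (s : R) : `[1, +oo[%classic (Num.max s 1).
  by rewrite /= in_itv /= andbT max1.
have max0 (s : R) : s <= Num.max s 1 by rewrite le_max lexx.
split; last by move=> x y xy; apply: hm => //; rewrite ge_max max1 andbT (le_trans xy).
apply/convex_onP => t x y /andP[t0 t1] _ _.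
apply: le_trans (fc t _ _ _ (M1 x) (M1 y)); last by rewrite t0.
have u0 : 0 <= 1 - t by rewrite subr_ge0.
have c1 : 1 <= t * Num.max x 1 + (1 - t) * Num.max y 1.
  rewrite -[leLHS](subrKC t); apply: lerD.
    by rewrite -[leLHS]mulr1 ler_wpM2l.
  by rewrite -[leLHS]mulr1 ler_wpM2l.
by apply: hm => //; rewrite ge_max c1 andbT lerD // ler_wpM2l.
Qed.

Lemma convex_comb_gt0 a b t : 0 < a -> 0 < b -> 0 <= t <= 1 ->
  0 < t * a + (1 - t) * b.
Proof.
move=> a0 b0 /andP[t0 t1].
have [->|tn] := eqVneq t 0; first by rewrite mul0r add0r subr0 mul1r.
apply: ltr_wpDr; first by rewrite mulr_ge0 ?subr_ge0 // ltW.
by rewrite mulr_gt0 // lt_neqAle eq_sym tn.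
Qed.

Lemma quad_over_lin_convex t x y a b : 0 < a -> 0 < b -> 0 <= t <= 1 ->
  (t * x + (1 - t) * y) ^+ 2 / (t * a + (1 - t) * b) <=
  t * (x ^+ 2 / a) + (1 - t) * (y ^+ 2 / b).
Proof.
move=> a0 b0 t01; have c0 := convex_comb_gt0 a0 b0 t01.
have [t0 u0] : 0 <= t /\ 0 <= 1 - t by case/andP: t01; rewrite subr_ge0.
rewrite -subr_ge0.
(* The convexity gap is an explicit square with nonnegative weight. *)
have -> : t * (x ^+ 2 / a) + (1 - t) * (y ^+ 2 / b) -
    (t * x + (1 - t) * y) ^+ 2 / (t * a + (1 - t) * b) =
    t * (1 - t) * (x * b - y * a) ^+ 2 / (a * b * (t * a + (1 - t) * b)).
  by field; rewrite !gt_eqF.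
apply: divr_ge0; first by rewrite mulr_ge0 ?sqr_ge0 // mulr_ge0.
by rewrite ltW // !mulr_gt0.
Qed.

Definition norm2 x y := Num.sqrt (x ^+ 2 + y ^+ 2).

Lemma norm2_ge0 x y : 0 <= norm2 x y. Proof. exact: sqrtr_ge0. Qed.

Lemma sqr_norm2 x y : norm2 x y ^+ 2 = x ^+ 2 + y ^+ 2.
Proof. by rewrite sqr_sqrtr // addr_ge0 ?sqr_ge0. Qed.

Lemma norm2Z t x y : 0 <= t -> norm2 (t * x) (t * y) = t * norm2 x y.
Proof.
move=> t0; rewrite /norm2 !exprMn -mulrDr sqrtrM ?sqr_ge0 // sqrtr_sqr.
by rewrite ger0_norm.
Qed.

(** After squaring, this is the Cauchy-Schwarz inequality, which follows from Lagrange's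
    identity. *)
Lemma norm2D x y z w : norm2 (x + z) (y + w) <= norm2 x y + norm2 z w.
Proof.
rewrite -(ler_pXn2r (n := 2)) ?nnegrE ?addr_ge0 ?norm2_ge0 //.
have cs : x * z + y * w <= norm2 x y * norm2 z w.
  apply: le_trans (ler_norm _) _.
  rewrite -(ler_pXn2r (n := 2)) ?nnegrE ?mulr_ge0 ?norm2_ge0 //.
  rewrite real_normK ?num_real // exprMn !sqr_norm2 -subr_ge0.
  have -> : (x ^+ 2 + y ^+ 2) * (z ^+ 2 + w ^+ 2) - (x * z + y * w) ^+ 2 =
    (x * w - y * z) ^+ 2 by ring.
  exact: sqr_ge0.
rewrite sqrrD !sqr_norm2; lra.
Qed.

(* The largest singular value: writing F as z |-> u z + v (conj z) on the complex
   plane, the singular values are |u| + |v| and | |u| - |v| |. *)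
Definition opnorm2 (F : 'M[R]_2) : R :=
  (norm2 (F 0 0 + F 1 1) (F 1 0 - F 0 1) +
   norm2 (F 0 0 - F 1 1) (F 1 0 + F 0 1)) / 2.

Lemma opnorm2_ge0 F : 0 <= opnorm2 F.
Proof. by rewrite divr_ge0 // addr_ge0 ?norm2_ge0. Qed.

(** Both summands of [opnorm2] are Euclidean norms of linear functions of F. *)
Lemma opnorm2_convex t F G : 0 <= t <= 1 ->
  opnorm2 (t *: F + (1 - t) *: G) <= t * opnorm2 F + (1 - t) * opnorm2 G.
Proof.
move=> /andP[t0 t1]; have u0 : 0 <= 1 - t by rewrite subr_ge0.
have cvx x y z w : norm2 (t * x + (1 - t) * z) (t * y + (1 - t) * w) <=
    t * norm2 x y + (1 - t) * norm2 z w.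
  by rewrite -!norm2Z // norm2D.
rewrite /opnorm2 !mulrA -mulrDl ler_pM2r // !mulrDr addrACA !mxE.
apply: lerD; apply: le_trans (cvx _ _ _ _); rewrite le_eqVlt; apply/orP; left;
  by apply/eqP; congr norm2; ring.
Qed.

Lemma singular_values_opnorm2 F : GLplus2 F ->
  [/\ 0 < opnorm2 F, singular_values F (opnorm2 F) (\det F / opnorm2 F) &
      1 <= opnorm2 F ^+ 2 / \det F].
Proof.
rewrite (mx22_eta F) /GLplus2 /= det_mx22 /opnorm2 !mxE /=.
move: (F 0 0) (F 0 1) (F 1 0) (F 1 1) => a b c d {F} D0.
set m := norm2 (a + d) _; set n := norm2 (a - d) _.
have m2 : m ^+ 2 = (a + d) ^+ 2 + (c - b) ^+ 2 by rewrite sqr_norm2.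
have n2 : n ^+ 2 = (a - d) ^+ 2 + (c + b) ^+ 2 by rewrite sqr_norm2.
have m0 : 0 <= m := norm2_ge0 _ _; have n0 : 0 <= n := norm2_ge0 _ _.
move: m n m2 n2 m0 n0 => m n m2 n2 m0 n0.
(* A positive determinant thus forces n < m, and the singular values become (m + n) / 2 and (m - n)
   / 2. *)
have mn : m ^+ 2 - n ^+ 2 = 4 * (a * d - b * c) by rewrite m2 n2; ring.
have nm : n < m.
  by rewrite -(ltr_pXn2r (n := 2)) ?nnegrE // -subr_gt0 mn mulr_gt0.
have s0 : 0 < m + n by rewrite ltr_wpDr // (le_lt_trans n0).
have DE : a * d - b * c = (m - n) / 2 * ((m + n) / 2).
  apply: (mulfI (x := 4)); first by rewrite pnatr_eq0.
  by rewrite -mn; field.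
have d0 : 0 < m - n by rewrite subr_gt0.
have sn : m + n != 0 by rewrite gt_eqF.
have dn : m - n != 0 by rewrite gt_eqF.
have -> : (a * d - b * c) / ((m + n) / 2) = (m - n) / 2.
  by rewrite DE; field.
split; first by rewrite divr_gt0.
- apply/singular_valuesP; split; try by rewrite divr_ge0 // ltW.
  + have -> : ((m + n) / 2) ^+ 2 + ((m - n) / 2) ^+ 2 =
      (m ^+ 2 + n ^+ 2) / 2 by field.
    by rewrite m2 n2; field.
  + by rewrite DE; ring.
- have -> : ((m + n) / 2) ^+ 2 / (a * d - b * c) = (m + n) / (m - n).
    by rewrite DE; field; rewrite sn dn.
  by rewrite ler_pdivlMr // mul1r; lra.
Qed.

End Convexity.

(** * The cycle of implications *)

Section Implications.
Context {R : realType} {W : 'M[R]_2 -> R} {g : R -> R -> R} {h : R -> R}.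

Lemma polyconvex_rank_one_convex : polyconvex W -> rank_one_convex W.
Proof.
move=> [P [_ Pc WP]] F t xi eta F0 t01 Ft.
have F1 : GLplus2 (F + xi *m eta^T).
  by have := Ft 1; rewrite scale1r; apply; rewrite ler01 lexx.
have Fs : GLplus2 (F + (1 - t) *: (xi *m eta^T)).
  by apply: Ft; move/andP: t01 => [t0 t1]; rewrite subr_ge0 t1 gerBl.
rewrite -lee_fin EFinD !EFinM !WP //.
have -> : F + (1 - t) *: (xi *m eta^T) =
    t *: F + (1 - t) *: (F + xi *m eta^T).
  by rewrite scalerDr addrA -scalerDl subrKC scale1r.
(* The quadratic term of the determinant along the line is a multiple of the determinant of
   [xi *m eta^T], which is zero. *)
have -> : \det (t *: F + (1 - t) *: (F + xi *m eta^T)) =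
    t * \det F + (1 - t) * \det (F + xi *m eta^T).
  have -> : xi *m eta^T = mx22 (xi 0 0 * eta 0 0) (xi 0 0 * eta 1 0)
      (xi 1 0 * eta 0 0) (xi 1 0 * eta 1 0).
    by apply: mx22P; rewrite !mxE big_ord1 !mxE.
  by rewrite (mx22_eta F) !(add_mx22, scale_mx22) !det_mx22; ring.
exact: Pc.
Qed.

Lemma diag_rank_one_convex (l k l' t : R) : rank_one_convex W -> 0 < l -> 0 < l' ->
  0 < k -> 0 <= t <= 1 ->
  W (mx22 (t * l + (1 - t) * l') 0 0 k) <=
    t * W (mx22 l 0 0 k) + (1 - t) * W (mx22 l' 0 0 k).
Proof.
move=> Wr l0 l'0 k0 t01.
(* The product [xi *m eta^T] has l' - l in the upper left corner and zeros elsewhere, so it moves l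
   to l'. *)
pose xi : 'cV[R]_2 := \col_i (if i == 0 then l' - l else 0).
pose eta : 'cV[R]_2 := \col_i (if i == 0 then 1 else 0).
have E : xi *m eta^T = mx22 (l' - l) 0 0 0.
  by apply: mx22P; rewrite !mxE big_ord1 !mxE /= ?mulr1 ?mulr0.
have D0 (s : R) : 0 < s -> GLplus2 (mx22 s 0 0 k).
  by move=> s0; rewrite /GLplus2 /= det_mx22 mulr0 subr0 mulr_gt0.
have := Wr (mx22 l 0 0 k) t xi eta (D0 l l0) t01.
rewrite E !add_mx22 scale_mx22 add_mx22 !mulr0 !addr0 subrKC.
have -> : l + (1 - t) * (l' - l) = t * l + (1 - t) * l' by ring.
apply=> s /andP[s0 s1]; rewrite scale_mx22 add_mx22 !mulr0 !addr0.
apply: D0; have -> : l + s * (l' - l) = (1 - s) * l + s * l' by ring.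
by rewrite addrC convex_comb_gt0 // s0.
Qed.

Context (Wgh : represents W g h).

Lemma rank_one_convex_separately_convex :
  rank_one_convex W -> separately_convex g.
Proof.
move=> Wr.
have gc (k l l' t : R) : 0 < k -> 0 < l -> 0 < l' -> 0 <= t <= 1 ->
    g (t * l + (1 - t) * l') k <= t * g l k + (1 - t) * g l' k.
  move=> k0 l0 l'0 t01; have c0 := convex_comb_gt0 l0 l'0 t01.
  have [<- _ _] := represents_diag Wgh c0 k0.
  have [<- _ _] := represents_diag Wgh l0 k0.
  have [<- _ _] := represents_diag Wgh l'0 k0.
  exact: diag_rank_one_convex.
(* Symmetry of g transfers convexity from the first variable to the second. *)
have gC (l k : R) : 0 < l -> 0 < k -> g l k = g k l.
  move=> l0 k0; have [_ -> _] := represents_diag Wgh l0 k0.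
  by have [_ _ ->] := represents_diag Wgh k0 l0.
split=> k k0; apply/convex_onP => t x y t01 /=;
  rewrite !in_itv /= !andbT => x0 y0; first exact: gc.
by rewrite ![g k _]gC ?convex_comb_gt0 //; apply: gc.
Qed.

Lemma separately_convex_convex : separately_convex g -> convex_on `]0, +oo[ h.
Proof.
move=> [/(_ 1 ltr01) /convex_onP gc _]; apply/convex_onP => t x y t01 Dx Dy.
have [x0 y0] : 0 < x /\ 0 < y.
  by move: Dx Dy; rewrite /= !in_itv /= !andbT.
by rewrite !(represents_ratio Wgh) ?convex_comb_gt0 //; apply: gc.
Qed.

(* For 1 <= x <= y, the point x lies between 1/y and y, where h agrees. *)
Lemma convex_nondecreasing : convex_on `]0, +oo[ h ->
  convex_on `[1, +oo[ h /\ nondecreasing_on `[1, +oo[ h.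
Proof.
move=> /convex_onP hc; split.
  apply/convex_onP => t x y t01; rewrite /= !in_itv /= !andbT => x1 y1.
  by apply: hc; rewrite //= in_itv /= andbT (lt_le_trans ltr01).
move=> x y; rewrite !inE /= !in_itv /= !andbT => x1 y1 xy.
(* Strict inequality gives y > 1, so the interval from 1/y to y has positive length. *)
have [->//|xNy] := eqVneq x y.
have y0 : 0 < y by rewrite (lt_le_trans ltr01).
have ltxy : x < y by rewrite lt_neqAle xNy.
have yV1 : y^-1 <= 1 by rewrite invf_le1.
have d0 : 0 < y - y^-1 by lra.
pose t := (x - y^-1) / (y - y^-1).
have t01 : 0 <= t <= 1.
  apply/andP; split; first by apply: divr_ge0; lra.
  by rewrite ler_pdivrMr // mul1r; lra.
have xE : x = t * y + (1 - t) * y^-1.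
  have -> : t * y + (1 - t) * y^-1 = t * (y - y^-1) + y^-1 by ring.
  by rewrite /t divfK ?gt_eqF // subrK.
have := hc t y y^-1 t01; rewrite /= !in_itv /= !andbT -xE invr_gt0 y0.
rewrite (represents_inv Wgh) // -mulrDl subrKC mul1r; exact.
Qed.

Lemma nondecreasing_polyconvex : convex_on `[1, +oo[ h ->
  nondecreasing_on `[1, +oo[ h -> polyconvex W.
Proof.
move=> hc hm; have [/convex_onP Hc Hm] := convex_on_extend1 hc hm.
set H := fun s : R => h (Num.max s 1) in Hc Hm.
(* The value +oo outside the convex half-space a > 0 preserves convexity. *)
exists (fun X a => if 0 < a then (H (opnorm2 X ^+ 2 / a))%:E else +oo%E).
split=> [X a|X Y a b t t01|F F0]; first by case: ifP.
(* The endpoints are separate because 0 * +oo = 0; for positive weights, one infinite value makes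
   the right-hand side +oo. *)
- have [->|t0] := eqVneq t 0.
    by rewrite !scale0r subr0 !scale1r !mul0r !mul1r !add0r mul0e add0e mul1e.
  have [->|t1] := eqVneq t 1.
    by rewrite subrr !scale0r !scale1r !mul0r !mul1r !addr0 mul0e adde0 mul1e.
  have tp : 0 < t by case/andP: t01 => t0' _; rewrite lt_neqAle eq_sym t0.
  have up : 0 < 1 - t.
    by case/andP: t01 => _ t1'; rewrite subr_gt0 lt_neqAle t1.
  case: (ltP 0 a) => a0; last first.
    rewrite mulry gtr0_sg // mul1e addye ?leey //.
    by case: ifP => _; [|rewrite mulry gtr0_sg // mul1e].
  case: (ltP 0 b) => b0; last first.
    by rewrite [((1 - t)%:E * _)%E]mulry gtr0_sg // mul1e addey ?leey.
  rewrite convex_comb_gt0 // -!EFinM -EFinD lee_fin.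
  apply: le_trans (Hc _ _ _ t01 I I).
  apply: Hm; apply: le_trans (quad_over_lin_convex _ _ a0 b0 t01).
  rewrite ler_pM2r ?invr_gt0 ?convex_comb_gt0 //.
  rewrite ler_pXn2r ?nnegrE ?opnorm2_ge0 ?opnorm2_convex //.
  by rewrite addr_ge0 // mulr_ge0 ?opnorm2_ge0 // ltW.
- have [L0 sF L1] := singular_values_opnorm2 F0.
  have [_ -> _] := Wgh F0 sF.
  move: (F0); rewrite /GLplus2 /= => d0; rewrite d0; congr (h _)%:E.
  (* By [L1] the argument is at least 1 on GL+(2), so there the extension agrees with h. *)
  rewrite max_l // invf_div mulrA -expr2 //.
Qed.

End Implications.

Theorem theorem3p3 (R : realType) (W : 'M[R]_2 -> R)
    (Woi : objective_isotropic W) (Wiso : isochoric W) :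
  [/\ exists (g : R -> R -> R) (h : R -> R), represents W g h,
      forall (g g' : R -> R -> R) (h h' : R -> R),
        represents W g h -> represents W g' h' ->
        (forall l1 l2 : R, 0 < l1 -> 0 < l2 -> g l1 l2 = g' l1 l2) /\
        (forall t : R, 0 < t -> h t = h' t) &
      forall (g : R -> R -> R) (h : R -> R), represents W g h ->
        [<-> polyconvex W;
             rank_one_convex W;
             separately_convex g;
             convex_on `]0, +oo[ h;
             convex_on `[1, +oo[ h /\ nondecreasing_on `[1, +oo[ h]].
Proof.
split.
- exists (fun l1 l2 => W (mx22 l1 0 0 l2)), (fun t => W (mx22 t 0 0 1)).
  exact: represents_exists.
- move=> g g' h h' r r'.
  have gg' l1 l2 : 0 < l1 -> 0 < l2 -> g l1 l2 = g' l1 l2.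
    move=> l10 l20; have [<- _ _] := represents_diag r l10 l20.
    by have [<- _ _] := represents_diag r' l10 l20.
  split=> // t t0.
  by rewrite (represents_ratio r) // (represents_ratio r') // gg'.
- move=> g h r; tfae.
  + exact: polyconvex_rank_one_convex.
  + exact: rank_one_convex_separately_convex r.
  + exact: separately_convex_convex r.
  + exact: convex_nondecreasing r.
  + by case; apply: nondecreasing_polyconvex r.
Qed.
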